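(* An SCF $f:\Theta\to Z$ satisfying $|f(\Theta)|\ge 2$ is mixed-Nash-implementable if and only if $\widehat{\mathcal L}^Y$-monotonicity holds.
   Context: Standing setup: $\mathcal I=\{1,\dots,I\}$ is a finite set of agents with $I\ge 3$; $\Theta$ is a finite or countably infinite set of states; $Z$ is a finite set of pure outcomes; $Y=\Delta(Z)$, each $z\in Z$ identified with the degenerate lottery at $z$. For each $(i,\theta)$, $u_i^\theta:Z\to\mathbb R$ and $U_i^\theta(y)=\sum_{z}y_zu_i^\theta(z)$. For $\alpha\in Y$: $\mathcal L_i^Y(\alpha,\theta)=\{y\in Y:U_i^\theta(\alpha)\ge U_i^\theta(y)\}$, $\mathcal L_i^Z(\alpha,\theta)=\{z\in Z:U_i^\theta(\alpha)\ge u_i^\theta(z)\}$. A mechanism is $\mathcal M=\langle M=\times_iM_i,g:M\to Y\rangle$ with each $M_i$ countable; $g(\lambda)$ is the lottery induced by a (mixed) profile $\lambda$; $MNE^{(\mathcal M,\theta)}$ is the set of mixed-strategy Nash equilibria at $\theta$. $f$ is mixed-Nash-implementable if some mechanism satisfies $\bigcup_{\lambda\in MNE^{(\mathcal M,\theta)}}\mathrm{SUPP}(g[\lambda])=\{f(\theta)\}$ for all $\theta$. A nonempty $E\subseteq Z$ is an $i$-$\theta$-max set if $E\subseteq\arg\max_{z\in E}u_i^\theta(z)$ and $E\subseteq\arg\max_{z\in Z}u_j^\theta(z)$ for all $j\neq i$; an $i$-max set if it is an $i$-$\theta$-max set for some $\theta$. For $(i,\theta)$ and $a\in Z$, define $\widehat{\mathcal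 L}_i^Y(a,\theta)=\{a\}$ if $a=f(\theta)\in\arg\min_{z\in Z}u_i^\theta(z)$ and $\mathcal L_i^Z(f(\theta),\theta)$ is an $i$-max set, and $\widehat{\mathcal L}_i^Y(a,\theta)=\mathcal L_i^Y(a,\theta)$ otherwise. $\widehat{\mathcal L}^Y$-monotonicity holds if for all $\theta,\theta'\in\Theta$: $\widehat{\mathcal L}_i^Y(f(\theta),\theta)\subseteq\mathcal L_i^Y(f(\theta),\theta')$ for all $i$ implies $f(\theta)=f(\theta')$. *)

(* Defs.v *)
From HB Require Import structures.
From mathcomp Require Import all_boot all_order all_algebra.
From mathcomp Require Import boolp classical_sets functions reals constructive_ereal ereal esum.
Set Implicit Arguments. Unset Strict Implicit. Unset Printing Implicit Defensive.
Import Order.TTheory GRing.Theory Num.Theory.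
Local Open Scope classical_set_scope.
Local Open Scope ring_scope.

Section Defs.
Variables (R : realType) (n : nat) (Theta : countType) (Z : finType).
(* agents are 'I_n; u i th z = u_i^theta(z) *)
Variable u : 'I_n -> Theta -> Z -> R.

Definition lottery (y : Z -> R) : Prop := (forall z, 0 <= y z) /\ \sum_(z : Z) y z = 1.

Definition delta (a : Z) : Z -> R := fun z => if z == a then 1 else 0.

Definition EU (i : 'I_n) (th : Theta) (y : Z -> R) : R := \sum_(z : Z) y z * u i th z.

Definition LY (i : 'I_n) (alpha : Z -> R) (th : Theta) : set (Z -> R) :=
  [set y | lottery y /\ EU i th y <= EU i th alpha].

Definition LZ (i : 'I_n) (alpha : Z -> R) (th : Theta) : set Z :=
  [set z | u i th z <= EU i th alpha].

Definition argmax_in (h : Z -> R) (E : set Z) : set Z :=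
  [set z | E z /\ forall z', E z' -> h z' <= h z].

Definition argmin_in (h : Z -> R) (E : set Z) : set Z :=
  [set z | E z /\ forall z', E z' -> h z <= h z'].

Definition imax_set_at (i : 'I_n) (th : Theta) (E : set Z) : Prop :=
  E !=set0 /\ E `<=` argmax_in (u i th) E /\
  (forall j : 'I_n, j != i -> E `<=` argmax_in (u j th) setT).

Definition imax_set (i : 'I_n) (E : set Z) : Prop := exists th, imax_set_at i th E.

Variable f : Theta -> Z.

Definition LYhat (i : 'I_n) (a : Z) (th : Theta) : set (Z -> R) :=
  if `[< a = f th /\ argmin_in (u i th) setT a /\ imax_set i (LZ i (delta (f th)) th) >]
  then [set delta a]
  else LY i (delta a) th.

Definition LYhat_monotonic : Prop :=
  forall th th' : Theta,
    (forall i : 'I_n, LYhat i (f th) th `<=` LY i (delta (f th)) th') ->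
    f th = f th'.

(* Mechanisms: message spaces M i (countable), outcome function g : M -> Y *)
Section Mechanism.
Variables (M : 'I_n -> countType) (g : {dffun forall i, M i} -> Z -> R).

Definition mixed (i : 'I_n) (mu : M i -> R) : Prop :=
  (forall m, 0 <= mu m) /\ (\esum_(m in [set: M i]) (mu m)%:E = 1)%E.

Definition glot (l : forall i, M i -> R) : Z -> R :=
  fun z => fine (\esum_(m in [set: {dffun forall i, M i}])
                   ((\prod_(i < n) l i (m i)) * g m z)%:E).

Definition MNE (th : Theta) : set (forall i, M i -> R) :=
  [set l | (forall i, mixed (l i)) /\
           forall (i : 'I_n) (mu : M i -> R), mixed mu ->
             EU i th (glot (dfwith l mu)) <= EU i th (glot l)].

Definition SUPP (y : Z -> R) : set Z := [set z | y z != 0].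

End Mechanism.

Definition mixed_Nash_implementable : Prop :=
  exists (M : 'I_n -> countType) (g : {dffun forall i, M i} -> Z -> R),
    (forall m, lottery (g m)) /\
    forall th : Theta, \bigcup_(l in MNE g th) SUPP (glot g l) = [set f th].

End Defs.

(* Main.v *)
Require Import Defs.
From HB Require Import structures.
From mathcomp Require Import all_boot all_order all_algebra.
From mathcomp Require Import boolp classical_sets functions reals constructive_ereal ereal esum.
From mathcomp Require Import finmap fsbigop cardinality ring lra.
(* Sufficiency uses the message space [Theta * nat]. If all integers are 0 and all agents but
   at most one report the same state [th], the outcome is [f th]. Otherwise an agent [j] with
   the highest integer [K] receives an almost best point, for the state it reports, of the
   set it may reach: [LYhat] at [th] when all the others report [(th, 0)], all lotteries
   otherwise. The point is moved slightly into the relative interior of that set. Letting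
   [K] grow, every profile in the support of an equilibrium at [th] gives each agent a best
   point of the set it may reach. An interior point is best only if the agent is
   indifferent on the whole set, so a profile with a winner [j] forces, at [th], either total
   indifference, which [|f(Theta)| >= 2] excludes, or a [j]-max set, where [LYhat] is a
   singleton and monotonicity applies. *)

Set Implicit Arguments. Unset Strict Implicit. Unset Printing Implicit Defensive.
Import Order.TTheory GRing.Theory Num.Theory.
Local Open Scope classical_set_scope.
Local Open Scope ring_scope.

(** * Expectations over a countable set *)

Section Mean.
Variables (R : realType) (T : choiceType) (w : T -> R).
Hypothesis w_ge0 : forall m, 0 <= w m.

(** [esum] is a supremum of finite partial sums, a true expectation only for nonnegative [h];
    payoffs are shifted accordingly. *)
Definition mean (h : T -> R) : \bar R := (\esum_(m in [set: T]) (w m * h m)%R%:E)%E.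



Lemma mean_ge0 (h : T -> R) : (forall m, 0 <= h m) -> (0 <= mean h)%E.
Proof. by move=> h0; apply: esum_ge0 => m _; rewrite lee_fin mulr_ge0. Qed.

Lemma eq_mean (h h' : T -> R) : (forall m, 0 < w m -> h m = h' m) -> mean h = mean h'.
Proof.
move=> hh; apply: eq_esum => m _; have := w_ge0 m.
by rewrite le_eqVlt => /predU1P[<-|/hh->//]; rewrite !mul0r.
Qed.

Lemma le_mean (h h' : T -> R) : (forall m, 0 < w m -> h m <= h' m) -> (mean h <= mean h')%E.
Proof.
move=> hh; apply: le_esum => m _; rewrite lee_fin; have := w_ge0 m.
by rewrite le_eqVlt => /predU1P[<-|w0]; rewrite ?mul0r// ler_wpM2l// hh.
Qed.

Lemma meanD (h h' : T -> R) : (forall m, 0 <= h m) -> (forall m, 0 <= h' m) ->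
  mean (fun m => h m + h' m) = (mean h + mean h')%E.
Proof.
move=> h0 h'0; rewrite /mean -esumD => [||m _]; last 2 first.
- by move=> m _; rewrite lee_fin mulr_ge0.
- by rewrite lee_fin mulr_ge0.
by apply: eq_esum => m _; rewrite mulrDr EFinD.
Qed.

Lemma mean_sum (Z : finType) (h : T -> Z -> R) : (forall m z, 0 <= h m z) ->
  mean (fun m => \sum_z h m z) = (\sum_z mean (h^~ z))%E.
Proof.
move=> h0; rewrite /mean -esum_sum => [|m z _ _]; last by rewrite lee_fin mulr_ge0.
by apply: eq_esum => m _; rewrite mulr_sumr sumEFin.
Qed.

Let meanZ_le (c : R) (h : T -> R) : 0 < c -> (forall m, 0 <= h m) ->
  (mean (fun m => (h m * c)%R) <= mean h * c%:E)%E.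
Proof.
move=> c0 h0; apply: ge_ereal_sup => _ [F [Ffin _]] <-.
have -> : (\sum_(m \in F) (w m * (h m * c))%R%:E =
           (\sum_(m \in F) (w m * h m)%R%:E) * c%:E)%E.
  rewrite !fsbig_finite//= ge0_sume_distrl => [|m _]; last by rewrite lee_fin mulr_ge0.
  by apply: eq_bigr => m _; rewrite mulrA EFinM.
rewrite lee_pmul2r//; apply: ereal_sup_ubound.
by exists F => //; split.
Qed.

(** The inequality opposite to [meanZ_le] is [meanZ_le] for [c^-1] and the scaled function. *)
Lemma meanZ (c : R) (h : T -> R) : 0 <= c -> (forall m, 0 <= h m) ->
  mean (fun m => h m * c) = (mean h * c%:E)%E.
Proof.
rewrite le_eqVlt => /predU1P[<- h0|c0 h0].
  by rewrite mule0 /mean esum1// => m _; rewrite !mulr0.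
apply/eqP; rewrite eq_le meanZ_le//=.
rewrite -lee_pdivlMr//; apply: le_trans (meanZ_le (c := c^-1) _ _); last 2 first.
- by rewrite invr_gt0.
- by move=> m; rewrite mulr_ge0// ltW.
by apply: le_mean => m _; rewrite -mulrA divff ?mulr1// gt_eqF.
Qed.

Hypothesis w1 : mean (fun=> 1) = 1%E.

Lemma mean_cst (c : R) : 0 <= c -> mean (fun=> c) = c%:E.
Proof.
move=> c0; rewrite -[RHS]mul1e -w1 -meanZ => [|//|m]; last exact: ler01.
by apply: eq_mean => m _; rewrite mul1r.
Qed.

Lemma mean_le_cst (c : R) h : 0 <= c -> (forall m, 0 < w m -> h m <= c) -> (mean h <= c%:E)%E.
Proof. by move=> c0 hc; rewrite -mean_cst//; apply: le_mean. Qed.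

Lemma mean_fin_num (c : R) h : (forall m, 0 <= h m <= c) -> mean h \is a fin_num.
Proof.
move=> hc; rewrite ge0_fin_numE; last by apply: mean_ge0 => m; case/andP: (hc m).
have [c0|c0] := leP 0 c.
  apply: le_lt_trans (mean_le_cst c0 _) (ltry _) => m _; by case/andP: (hc m).
rewrite /mean esum1 ?ltry// => m; case/andP: (hc m) => h1 /(le_trans h1).
by rewrite leNgt c0.
Qed.

Lemma mean_pointE m0 : mean (fun m => (m == m0)%:R) = (w m0)%:E.
Proof.
rewrite -[RHS](esum_set1 (t := m0) (a := fun m => (w m)%:E)) ?lee_fin//.
rewrite esum_mkcond; apply: eq_esum => m _.
rewrite (_ : (m \in [set m0]) = (m == m0)); first by case: eqP; rewrite ?mulr1 ?mulr0.
by apply/idP/eqP; rewrite in_setE.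
Qed.

(** Some finite set carries mass above [1 - d]; [K0] exceeds [r] on all of it. *)
Lemma mean_tail (r : T -> nat) (d : R) : 0 < d ->
  exists K0 : nat, forall K : nat, (K0 <= K)%N -> (mean (fun m => (K <= r m)%N%:R) <= d%:E)%E.
Proof.
move=> d0; have : ((1 - d)%R%:E < mean (fun=> 1%R))%E by rewrite w1 lte_fin ltrBlDr ltrDl.
move=> /ereal_sup_gt[_ [F [Ffin _] <-]].
rewrite fsbig_finite//= => dF.
exists (\max_(m <- finmap.enum_fset (fset_set F)) (r m).+1)%N => K leK.
pose inF m : R := (m \in F)%:R.
have mF : ((1 - d)%:E <= mean inF)%E.
  apply: le_trans (ltW dF) _.
  apply: esum_ge; exists F; first by split.
  rewrite fsbig_finite//=.
  rewrite le_eqVlt; apply/orP; left; apply/eqP; apply: eq_big_seq => m.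
  by rewrite in_fset_set// /inF => ->.
have : (mean (fun m => (K <= r m)%N%:R) + mean inF <= 1)%E.
  rewrite -meanD => [||m]; [|by move=> m; rewrite ler0n|by rewrite ler0n].
  apply: mean_le_cst => // m _; rewrite /inF.
  case: (boolP (m \in F)) => mF'; last by rewrite addr0 lern1 leq_b1.
  rewrite leqNgt (leq_trans _ leK) ?add0r//.
  rewrite (big_rem m) ?in_fset_set//=; exact: leq_maxl.
have t1 : mean (fun m => (K <= r m)%N%:R) \is a fin_num.
  by apply: (mean_fin_num (c := 1)) => m; rewrite ler0n lern1 leq_b1.
have t2 : mean inF \is a fin_num.
  by apply: (mean_fin_num (c := 1)) => m; rewrite ler0n lern1 leq_b1.
move: mF; rewrite -(fineK t1) -(fineK t2) -EFinD !lee_fin; lra.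
Qed.

(** [A' K] stands for the payoff after a deviation to the integer [K]. Its possible losses vanish as
    [K] grows, whereas a gain [eta * w m0] would not. *)
Lemma mean_no_gain (r : T -> nat) (A : T -> R) (A' : nat -> T -> R) (b c eta : R) m0 :
  (forall m, 0 <= A m <= b) -> (forall K m, 0 <= A' K m <= b) -> 0 < eta -> 0 <= c ->
  (forall K, mean (A' K) <= mean A)%E ->
  (forall K m, (r m < K)%N -> A m <= A' K m + c / K.+1%:R) ->
  (forall K, (r m0 < K)%N -> A m0 + eta <= A' K m0 + c / K.+1%:R) ->
  w m0 = 0.
Proof.
move=> Ab A'b eta0 c0 leA AA' Am0; apply/eqP; rewrite eq_le w_ge0 andbT leNgt.
apply/negP => w0; have b0 : 0 <= b by case/andP: (Ab m0) => /le_trans; apply.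
set e := eta * w m0; have e0 : 0 < e by rewrite mulr_gt0.
have beta0 : 0 < b + eta by rewrite ltr_wpDl.
(* The tail, scaled by [b + eta], and the loss [c / K.+1] are each held to a third of [e], so
   together they cannot offset [e]. *)
have [K0 HK0] := @mean_tail r (e / 3 / (b + eta)) ltac:(by rewrite !divr_gt0).
pose K := maxn K0 (Num.bound (3 * c / e)).
have {}HK0 := HK0 K (leq_maxl _ _).
have cK : c / K.+1%:R < e / 3.
  rewrite ltr_pdivrMr// -ltr_pdivrMl ?divr_gt0//.
  rewrite (_ : _ * c = 3 * c / e); last first.
    have e1 : e != 0 by rewrite gt_eqF.
    by field.
  apply: lt_le_trans (archi_boundP _) _; first by apply: divr_ge0 (ltW e0); apply: mulr_ge0.
  by rewrite ler_nat (leq_trans (leq_maxr K0 _)).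
have cK0 : 0 <= c / K.+1%:R by rewrite divr_ge0.
(* On the tail [K <= r m], whose mass vanishes, the difference is at most [b + eta]. *)
have key : (mean A + mean (fun m => ((m == m0)%:R * eta)%R) <=
    mean (A' K) + (mean (fun=> (c / K.+1%:R)%R) +
      mean (fun m => ((K <= r m)%N%:R * (b + eta))%R)))%E.
  have A0 m : 0 <= A m by case/andP: (Ab m).
  have A'0 m : 0 <= A' K m by case/andP: (A'b K m).
  have p1 m : 0 <= (m == m0)%:R * eta by rewrite mulr_ge0// ltW.
  have p2 m : 0 <= (K <= r m)%N%:R * (b + eta) by rewrite mulr_ge0// ltW.
  have p3 m : 0 <= c / K.+1%:R + (K <= r m)%N%:R * (b + eta) by rewrite addr_ge0.
  rewrite -(meanD A0 p1) -(meanD (fun=> cK0) p2) -(meanD A'0 p3).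
  apply: le_mean => m _.
  have [Kr|rK] := leqP K (r m).
    rewrite mul1r; have /andP[_ Am] := Ab m.
    suff : (m == m0)%:R * eta <= eta.
      by move: ((m == m0)%:R * eta) (c / K.+1%:R) cK0 (A'0 m) Am => x y; lra.
    by case: eqP; rewrite ?mul1r ?mul0r// ltW.
  rewrite mul0r addr0; case: eqP rK => [->|_] rK; first by rewrite mul1r Am0.
  by rewrite mul0r addr0 AA'.
have fA : mean A \is a fin_num by exact: mean_fin_num Ab.
have fA' : mean (A' K) \is a fin_num by exact: mean_fin_num (A'b K).
have ft : mean (fun m => (K <= r m)%N%:R) \is a fin_num.
  by apply: (mean_fin_num (c := 1)) => m; rewrite ler0n lern1 leq_b1.
have ind0 (B : pred T) m : 0 <= (B m)%:R :> R by rewrite ler0n.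
move: key (leA K) HK0; rewrite (meanZ (ltW eta0) (ind0 (pred1 m0))).
rewrite (meanZ (ltW beta0) (ind0 (fun m => K <= r m)%N)) mean_pointE mean_cst//.
rewrite -(fineK fA) -(fineK fA') -(fineK ft) -!EFinM -!EFinD !lee_fin.
rewrite ler_pdivlMr// => key leAA tl.
move: key leAA tl cK cK0; rewrite [w m0 * _]mulrC -/e.
by move: (c / _) (fine (mean A)) (fine _) (fine _ * _) => x y z t; lra.
Qed.

End Mean.

(** * Product weights of mixed profiles and pure deviations *)

Section Profile.
Variables (R : realType) (n : nat) (M : 'I_n -> countType).
Local Notation profile := {dffun forall i, M i}.
Implicit Types (l : forall i, M i -> R) (m : profile).

Definition weight l m : R := \prod_(i < n) l i (m i).

Definition dirac i (x : M i) : M i -> R := fun y => (y == x)%:R.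

Definition upd i (x : M i) m : profile := finfun (dfwith m x).

Lemma upd_in i (x : M i) m : upd x m i = x.
Proof. by rewrite ffunE dfwith_in. Qed.

Lemma upd_out i (x : M i) m j : j != i -> upd x m j = m j.
Proof. by move=> ji; rewrite ffunE dfwith_out// eq_sym. Qed.

Lemma upd_id i m : upd (m i) m = m.
Proof.
apply/ffunP => j; have [->|ji] := eqVneq j i; first by rewrite upd_in.
by rewrite upd_out.
Qed.

Lemma upd_upd i (x y : M i) m : upd x (upd y m) = upd x m.
Proof.
apply/ffunP => j; have [->|ji] := eqVneq j i; first by rewrite !upd_in.
by rewrite !upd_out.
Qed.

Lemma mixed_dirac i (x : M i) : mixed (dirac x : M i -> R).
Proof.
split=> [y|]; first exact: ler0n.
rewrite -[RHS](esum_set1 (t := x) (a := fun=> 1%E))// [RHS]esum_mkcond.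
apply: eq_esum => y _; rewrite (_ : (y \in [set x]) = (y == x)); first by rewrite /dirac; case: eqP.
by apply/idP/eqP; rewrite in_setE.
Qed.

Lemma mixed_mean1 i (mu : M i -> R) : mixed mu -> mean mu (fun=> 1) = 1%E.
Proof. by case=> _ <-; apply: eq_esum => x _; rewrite mulr1. Qed.

Lemma weight_ge0 l m : (forall i, mixed (l i)) -> 0 <= weight l m.
Proof. by move=> lm; apply: prodr_ge0 => i _; case: (lm i). Qed.

Lemma mixed_dfwith l i (mu : M i -> R) : (forall i, mixed (l i)) -> mixed mu ->
  forall j, mixed (dfwith l mu j).
Proof. by move=> lm mum j; case: dfwithP. Qed.

Lemma weightD1 l i m : weight l m = l i (m i) * \prod_(j | j != i) l j (m j).
Proof. by rewrite /weight (bigD1 i). Qed.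

Lemma weight_dfwith l i (mu : M i -> R) m :
  weight (dfwith l mu) m = mu (m i) * \prod_(j | j != i) l j (m j).
Proof.
rewrite (weightD1 _ i) dfwith_in; congr (_ * _); apply: eq_bigr => j ji.
by rewrite dfwith_out// eq_sym.
Qed.

(** Allows a pure deviation to be compared with the original profile pointwise, under the same
    weights. *)
Lemma mean_dfwith_dirac l i (x : M i) (h : profile -> R) :
  (forall i, mixed (l i)) -> (forall m, 0 <= h m) ->
  mean (weight (dfwith l (dirac x))) h = mean (weight l) (fun m => h (upd x m)).
Proof.
move=> lm h0; pose rest m := \prod_(j | j != i) l j (m j).
have rest0 m : 0 <= rest m by apply: prodr_ge0 => j _; case: (lm j).
pose I := [set m : profile | m i = x].
have -> : mean (weight (dfwith l (dirac x))) h = (\esum_(m in I) (rest m * h m)%R%:E)%E.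
  rewrite [RHS]esum_mkcond; apply: eq_esum => m _; rewrite weight_dfwith -/(rest m) /dirac.
  rewrite (_ : (m \in I) = (m i == x)); last by apply/idP/eqP; rewrite in_setE.
  by case: eqP; rewrite ?mul1r ?mul0r.
(* Every profile is one with [i]-th message [x], plus the message put in its place; the latter sums
   out to the mass 1 of [l i]. *)
pose e (k : profile * M i) : profile := upd k.2 k.1.
have ebij : set_bij (I `*`` (fun=> [set: M i])) [set: profile] e.
  split=> [//|[m y] [m' y']|m _]; rewrite ?in_setE /I /e /=.
    move=> [mx _] [m'x _] emm'; have yy' : y = y' by rewrite -(upd_in y m) emm' upd_in.
    by rewrite -{}yy' in emm' *; rewrite -(upd_id i m) -(upd_id i m') mx m'x
      -(upd_upd x y m) emm' upd_upd.
  by exists (upd x m, m i) => /=; rewrite ?upd_upd ?upd_id// /I/= upd_in.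
rewrite /mean (reindex_esum _ _ _ _ ebij) -(esum_esum (a := fun m y =>
  (weight l (e (m, y)) * h (upd x (e (m, y))))%R%:E)) => [|m y _ _]; last first.
  by rewrite lee_fin mulr_ge0// weight_ge0.
apply: eq_esum => m mx; have rh0 : 0 <= rest m * h m by rewrite mulr_ge0.
rewrite -(mean_cst (proj1 (lm i)) (mixed_mean1 (lm i)) rh0).
apply: eq_esum => y _; congr EFin; rewrite (weightD1 _ i) /e/= upd_in upd_upd -mulrA.
congr (_ * (_ * h _)); first by apply: eq_bigr => j ji; rewrite upd_out.
by rewrite -(mx : m i = x) upd_id.
Qed.

Lemma mixed_pos i (mu : M i -> R) : mixed mu -> exists x, 0 < mu x.
Proof.
case=> mu0 mu1; apply/not_existsP => no; move: mu1.
rewrite esum1 => [/eqP|x _]; first by rewrite eqe eq_sym oner_eq0.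
by congr EFin; apply/eqP; rewrite eq_le mu0 andbT leNgt; apply/negP/no.
Qed.

(* Replacing the strategies one at a time by point masses preserves the total weight,
   and a profile of point masses has total weight 1. *)
Lemma mean_weight1 l : (forall i, mixed (l i)) -> mean (weight l) (fun=> 1) = 1%E.
Proof.
move=> lm; have [x _] : exists x : forall i, M i, True.
  by exists (fun i => projT1 (cid (mixed_pos (lm i)))).
pose L s := foldr (fun i k => dfwith k (dirac (x i))) l s.
have Lm s i : mixed (L s i).
  by elim: s i => [|j s IHs] i //=; apply: mixed_dfwith => //; exact: mixed_dirac.
have LE s i : i \in s -> L s i = dirac (x i).
  elim: s => //= j s IHs; have [<-|ji] := eqVneq j i; first by rewrite dfwith_in.
  by rewrite dfwith_out// inE eq_sym (negPf ji) => /IHs.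
transitivity (mean (weight (L (enum 'I_n))) (fun=> 1)).
  elim: (enum _) => //= i s ->.
  by rewrite mean_dfwith_dirac//= => m; rewrite ler01.
pose m0 : profile := finfun x.
transitivity (\esum_(m in [set m0]) 1%E : \bar R)%E; last by rewrite esum_set1.
rewrite [RHS]esum_mkcond; apply: eq_esum => m _; rewrite mulr1.
rewrite (_ : (m \in [set m0]) = (m == m0)); last by apply/idP/eqP; rewrite in_setE.
rewrite /weight; case: eqP => [->|/eqP mm0].
  by congr EFin; apply: big1 => i _; rewrite LE ?mem_enum// /m0 ffunE /dirac eqxx.
have [i mi] : exists i, m i != x i.
  apply/not_existsP => no; move/negP: mm0; apply; apply/eqP/ffunP => i.
  by rewrite ffunE; apply/eqP; move: (no i) => /negP; rewrite negbK.
by rewrite (bigD1 i)//= LE ?mem_enum// /dirac (negPf mi) mul0r.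
Qed.

Lemma weight_gt0 l m : (forall i, mixed (l i)) -> 0 < weight l m -> forall i, 0 < l i (m i).
Proof.
move=> lm w0 i; rewrite lt0r; have [-> _] := lm i; rewrite andbT.
by apply: contraTN w0 => /eqP li0; rewrite (weightD1 _ i) li0 mul0r ltxx.
Qed.

End Profile.

(** * Lotteries, half-spaces and relative interior points *)

Section Lotteries.
Variables (R : realType) (Z : finType).
Implicit Types (y v h : Z -> R) (S : set (Z -> R)) (a : Z) (t d c : R).

Definition dot y v : R := \sum_z y z * v z.

Definition mix (t : R) y y' : Z -> R := fun z => (1 - t) * y z + t * y' z.

Lemma dot_delta a v : dot (delta R a) v = v a.
Proof.
rewrite /dot (bigD1 a)//= /delta eqxx mul1r big1 ?addr0// => z /negPf->.
by rewrite mul0r.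
Qed.

Lemma lottery_delta a : lottery (delta R a).
Proof.
split=> [z|]; first by rewrite /delta; case: eqP; rewrite ?ler01.
by rewrite -[RHS](dot_delta a (fun=> 1)); apply: eq_bigr => z _; rewrite mulr1.
Qed.

Lemma dot_mix t y y' v : dot (mix t y y') v = (1 - t) * dot y v + t * dot y' v.
Proof.
by rewrite /dot !mulr_sumr -big_split; apply: eq_bigr => z _; rewrite /mix/= mulrDl !mulrA.
Qed.

Lemma dot_lottery_eq y v d : lottery y -> (forall z, y z != 0 -> v z = d) -> dot y v = d.
Proof.
move=> [_ y1] vd; rewrite -[RHS]mul1r -y1 mulr_suml; apply: eq_bigr => z _.
by have [->|/vd->//] := eqVneq (y z) 0; rewrite !mul0r.
Qed.

Lemma dot_shift y v d : lottery y -> dot y (fun z => v z + d) = dot y v + d.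
Proof.
move=> ly; rewrite -[d in RHS](dot_lottery_eq (v := fun=> d) ly)// /dot -big_split.
by apply: eq_bigr => z _; rewrite mulrDr.
Qed.

Lemma le_dot y v v' : lottery y -> (forall z, v z <= v' z) -> dot y v <= dot y v'.
Proof. by move=> [y0 _] vv'; apply: ler_sum => z _; rewrite ler_wpM2l. Qed.

Lemma dot_le y v d : lottery y -> (forall z, v z <= d) -> dot y v <= d.
Proof.
by move=> ly vd; rewrite -[leRHS](dot_lottery_eq (v := fun=> d) ly)//; exact: le_dot.
Qed.

Lemma dot_ge y v d : lottery y -> (forall z, d <= v z) -> d <= dot y v.
Proof.
by move=> ly vd; rewrite -[leLHS](dot_lottery_eq (v := fun=> d) ly)//; exact: le_dot.
Qed.

Definition bound v : R := \sum_z `|v z|.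

Lemma bound_ge0 v : 0 <= bound v.
Proof. exact: sumr_ge0. Qed.

Lemma le_bound v z : `|v z| <= bound v.
Proof. by rewrite /bound (bigD1 z)//= lerDl sumr_ge0. Qed.

Lemma dot_bound y v : lottery y -> - bound v <= dot y v <= bound v.
Proof.
move=> ly; apply/andP; split.
  by apply: dot_ge => // z; have := le_bound v z; rewrite ler_norml => /andP[].
by apply: dot_le => // z; have := le_bound v z; rewrite ler_norml => /andP[].
Qed.

Lemma lottery_mix t y y' : 0 <= t <= 1 -> lottery y -> lottery y' -> lottery (mix t y y').
Proof.
move=> /andP[t0 t1] [y0 y1] [y'0 y'1]; split=> [z|].
  by rewrite addr_ge0// mulr_ge0// subr_ge0.
by rewrite big_split/= -!mulr_sumr y1 y'1 !mulr1 subrK.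
Qed.

Lemma dot_argmax y v d : lottery y -> (forall z, v z <= d) -> d <= dot y v ->
  forall z, y z != 0 -> v z = d.
Proof.
move=> ly vd dy z yz; have [y0 _] := ly.
have : \sum_z y z * (d - v z) <= 0.
  under eq_bigr do rewrite mulrBr.
  by rewrite sumrB -mulr_suml (proj2 ly) mul1r subr_le0.
have nn z' : 0 <= y z' * (d - v z') by rewrite mulr_ge0 ?subr_ge0.
rewrite (bigD1 z)//= => le0; apply/eqP; rewrite eq_sym -subr_eq0.
have : y z * (d - v z) <= 0 by apply: le_trans le0; rewrite lerDl sumr_ge0.
move=> yle; have /eqP : y z * (d - v z) = 0 by apply/eqP; rewrite eq_le yle nn.
by rewrite mulf_eq0 (negPf yz).
Qed.

Lemma dot_argmin y v d : lottery y -> (forall z, d <= v z) -> dot y v <= d ->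
  forall z, y z != 0 -> v z = d.
Proof.
move=> ly dv yd z yz; apply: oppr_inj.
apply: (dot_argmax (y := y) (v := fun z => - v z)) => // [z'|].
  by rewrite lerN2.
have -> : dot y (fun z => - v z) = - dot y v.
  by rewrite /dot -sumrN; apply: eq_bigr => z' _; rewrite mulrN.
by rewrite lerN2.
Qed.

Lemma lottery_eq_delta y a : lottery y -> (forall z, y z != 0 -> z = a) -> y = delta R a.
Proof.
move=> [_ y1] ya; have y0 z : z != a -> y z = 0.
  by move=> za; apply/eqP; apply: contraNT za => /ya->.
apply/funext => z; rewrite /delta; case: eqP => [->|/eqP]; last exact: y0.
by rewrite -y1 (bigD1 a)//= big1 ?addr0.
Qed.

(* A point of the relative interior of [S]. *)
Definition generic S y := S y /\
  forall v, (forall y', S y' -> dot y' v <= dot y v) -> forall y', S y' -> dot y' v = dot y v.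

Definition halfspace h (c : R) : set (Z -> R) := [set y | lottery y /\ dot y h <= c].

(** [y] is the average of the [X z], and an average that is at least each of its terms equals all of
    them. *)
Lemma generic_avg h c (P : pred Z) (X : Z -> Z -> R) : (exists z, P z) ->
  (forall z, P z -> halfspace h c (X z)) ->
  exists2 y, halfspace h c y & forall v, (forall z, P z -> dot (X z) v <= dot y v) ->
    forall z, P z -> dot (X z) v = dot y v.
Proof.
move=> [z0 Pz0] HX; pose N : R := (#|P|)%:R.
have N0 : 0 < N by rewrite ltr0n; apply/card_gt0P; exists z0.
pose y z' := N^-1 * \sum_(z | P z) X z z'.
have sumc c' : \sum_(z | P z) c' = N * c' by rewrite sumr_const -mulr_natl.
have dy v : N * dot y v = \sum_(z | P z) dot (X z) v.
  rewrite exchange_big /dot mulr_sumr; apply: eq_bigr => z' _.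
  by rewrite /y !mulrA divff ?mul1r ?gt_eqF// mulr_suml.
exists y.
  have le p q : N * p <= N * q -> p <= q by rewrite ler_pM2l.
  split; last by apply: le; rewrite dy -sumc; apply: ler_sum => z /HX[].
  split=> [z|].
    apply: mulr_ge0; first by rewrite invr_ge0 ltW.
    by apply: sumr_ge0 => z' /HX[[]].
  transitivity (dot y (fun=> 1)); first by apply: eq_bigr => z _; rewrite mulr1.
  apply: (mulfI (x := N)); first by rewrite gt_eqF.
  rewrite dy -sumc; apply: eq_bigr => z /HX[lX _]; exact: dot_lottery_eq.
move=> v vX z Pz; apply/eqP; rewrite eq_le vX//= leNgt; apply/negP => lt.
have : N * dot y v < N * dot y v; last by rewrite ltxx.
rewrite {1}dy -sumc (bigD1 z)//= [ltRHS](bigD1 z)//= ltr_leD//.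
by apply: ler_sum => z' /andP[Pz' _]; exact: vX.
Qed.

(** Shrinking the simplex towards a vertex with slack brings all its vertices into the
    half-space. *)
Lemma halfspace_slack h c z0 : h z0 < c ->
  exists2 t, 0 < t <= 1 & forall z, halfspace h c (mix t (delta R z0) (delta R z)).
Proof.
(* [D] dominates [c - h z0], whence [t <= 1], and every [h z - h z0], so that the move costs at most
   the slack. *)
move=> hz0; pose D := c - h z0 + \sum_z `|h z - h z0|.
have p0 : 0 < c - h z0 by rewrite subr_gt0.
have s0 : 0 <= \sum_z `|h z - h z0| by exact: sumr_ge0.
have D0 : 0 < D by rewrite ltr_pwDl.
have t1 : 0 < (c - h z0) / D <= 1.
  by rewrite divr_gt0//= ler_pdivrMr// mul1r lerDl.
exists ((c - h z0) / D) => // z; split.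
  apply: lottery_mix; [|exact: lottery_delta..].
  by case/andP: t1 => /ltW-> ->.
rewrite dot_mix !dot_delta.
have : (c - h z0) / D * (h z - h z0) <= c - h z0.
  rewrite mulrAC ler_pdivrMr// ler_pM2l//.
  apply: le_trans (ler_norm _) _; apply: le_trans (_ : \sum_z `|h z - h z0| <= _).
    by rewrite (bigD1 z)//= lerDl sumr_ge0.
  by rewrite lerDr ltW.
by move: (_ / D) => t; lra.
Qed.

(** With slack, average the vertices of a shrunken simplex: a functional constant on them is
    constant on all lotteries. Without slack, the half-space is a face of the simplex; average its
    vertices. *)
Lemma generic_halfspace h c a : h a <= c -> exists y, generic (halfspace h c) y.
Proof.
move=> hac; have [[z0 hz0]|no] := pselect (exists z0, h z0 < c).
  have [t /andP[t0 t1] HX] := halfspace_slack hz0.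
  have [||y Hy yv] := @generic_avg h c predT (fun z => mix t (delta R z0) (delta R z)).
  - by exists a.
  - by move=> z _; exact: HX.
  exists y; split=> // v vy y' [ly' _].
  have {}yv z : (1 - t) * v z0 + t * v z = dot y v.
    by rewrite -(yv v _ z)// => [|z' _]; rewrite ?vy// dot_mix !dot_delta.
  (* The shrinking fixes the vertex [z0]. *)
  have vz0 : v z0 = dot y v by rewrite -(yv z0); ring.
  apply: dot_lottery_eq => // z _; apply: (mulfI (x := t)); first by rewrite gt_eqF.
  by have := yv z; rewrite vz0; lra.
have {}no z : c <= h z by rewrite leNgt; apply/negP => hz; apply: no; exists z.
have [||y Hy yv] := @generic_avg h c (fun z => h z <= c) (@delta R Z).
- by exists a.
- by move=> z hz; split; [exact: lottery_delta|rewrite dot_delta].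
exists y; split=> // v vy y' [ly' y'c]; apply: dot_lottery_eq => // z y'z.
rewrite -(yv v _ z) ?dot_delta// => [z' hz'|].
  by apply: vy; split; [exact: lottery_delta|rewrite dot_delta].
by rewrite (dot_argmin ly' no y'c y'z).
Qed.

(** Tested on minus the indicator of [z]: if [y z = 0], then [y] is a maximiser, so all of [S]
    vanishes at [z]. *)
Lemma generic_supp S y : generic S y -> (forall y', S y' -> lottery y') ->
  forall y' z, S y' -> y' z != 0 -> y z != 0.
Proof.
move=> [Sy gy] Sl y' z Sy'; apply: contraNneq => yz.
pose v z' : R := - (z' == z)%:R.
have dv y'' : dot y'' v = - y'' z.
  rewrite /dot (bigD1 z)//= /v eqxx mulrN1 big1 ?addr0// => z' /negPf->.
  by rewrite oppr0 mulr0.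
have := gy v _ y' Sy'; rewrite !dv yz => /(_ _)/eqP; rewrite oppr0 oppr_eq0; apply.
by move=> y'' /Sl[y''0 _]; rewrite dv oppr_le0.
Qed.

Lemma approx_max S v (e : R) : 0 < e -> S !=set0 -> (forall y, S y -> lottery y) ->
  exists2 y, S y & forall y', S y' -> dot y' v <= dot y v + e.
Proof.
move=> e0 [y0 Sy0] Sl; pose E := [set dot y v | y in S].
have hE : has_sup E.
  split; first by exists (dot y0 v), y0.
  by exists (bound v) => _ [y /Sl ly <-]; case/andP: (dot_bound v ly).
have [_ [y Sy <-] ylt] := sup_adherent e0 hE; exists y => // y' Sy'.
have : dot y' v <= sup E by apply: ub_le_sup; [case: hE|exists y'].
by move: ylt; lra.
Qed.

End Lotteries.

(** * The lottery induced by a mixed profile *)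

Section InducedLottery.
Variables (R : realType) (n : nat) (Z : finType) (M : 'I_n -> countType).
Variables (g : {dffun forall i, M i} -> Z -> R) (l : forall i, M i -> R).
Arguments l : clear implicits.
Hypotheses (lg : forall m, lottery (g m)) (lm : forall i : 'I_n, mixed (l i)).

Let w0 (m : {dffun forall i, M i}) : 0 <= weight l m. Proof. exact: weight_ge0. Qed.
Let w1 : mean (weight l) (fun=> 1) = 1%E. Proof. exact: mean_weight1. Qed.

(** The [fine] in [glot] is harmless: each coordinate is a mean of values between 0 and 1. *)
Lemma glot_dot (v : Z -> R) : (forall z, 0 <= v z) ->
  (dot (glot g l) v)%:E = mean (weight l) (fun m => dot (g m) v).
Proof.
move=> v0; have g0 m z : 0 <= g m z by case: (lg m).
rewrite mean_sum// => [|m z]; last by rewrite mulr_ge0.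
rewrite /dot -sumEFin; apply: eq_bigr => z _.
rewrite (meanZ w0 (v0 z) (g0 ^~ z)) EFinM fineK//.
apply: (mean_fin_num w0 w1 (c := 1)) => m; rewrite g0/=.
by case: (lg m) => _ <-; rewrite (bigD1 z)//= lerDl sumr_ge0.
Qed.

Lemma lottery_glot : lottery (glot g l).
Proof.
split=> [z|].
  by rewrite fine_ge0// (mean_ge0 w0 (h := g^~ z))// => m; case: (lg m).
apply: EFin_inj; rewrite -[RHS]w1.
transitivity ((dot (glot g l) (fun=> 1))%:E).
  by congr EFin; apply: eq_bigr => z _; rewrite mulr1.
by rewrite glot_dot//; apply: eq_mean => // m _; exact: dot_lottery_eq.
Qed.

(** Adding [bound v] makes all payoffs nonnegative, as [mean] requires. *)
Lemma glot_dot_shift (v : Z -> R) :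
  (dot (glot g l) v + bound v)%:E = mean (weight l) (fun m => dot (g m) v + bound v).
Proof.
rewrite -(dot_shift _ _ lottery_glot) glot_dot => [|z].
  by apply: eq_mean => // m _; rewrite dot_shift.
by have := le_bound v z; rewrite ler_norml => /andP[]; rewrite lerNl -subr_ge0 opprK addrC.
Qed.

Lemma glot_dot_le (v : Z -> R) (c : R) :
  (forall m, 0 < weight l m -> dot (g m) v <= c) -> dot (glot g l) v <= c.
Proof.
move=> gc; rewrite -(lerD2r (bound v)) -lee_fin glot_dot_shift.
apply: (mean_le_cst w0 w1) => [|m wm]; last by rewrite lerD2r gc.
(* One profile of positive weight gives [0 <= c + bound v], which [mean_le_cst] asks for. *)
have [m [wm]] : exists m, 0 < weight l m.
  apply/not_existsP => no; have := w1.
  rewrite (eq_mean w0 (h' := fun=> 0)) => [|m /no//].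
  by rewrite (mean_cst w0 w1)// => /eqP; rewrite eqe eq_sym oner_eq0.
rewrite -[c + _](subrK (dot (g m) v)).
by have /andP[+ _] := dot_bound v (lg m); have := gc m wm; lra.
Qed.

Lemma glot_delta a : (forall m, 0 < weight l m -> g m = delta R a) -> glot g l = delta R a.
Proof.
move=> ga; apply/funext => z.
transitivity (fine (mean (weight l) (fun=> delta R a z))).
  by congr fine; apply: eq_mean => // m wm; rewrite ga.
rewrite (mean_cst w0 w1)//.
by case: (@lottery_delta R Z a).
Qed.

End InducedLottery.

(** * Implementability implies monotonicity *)

Section Necessity.
Variables (R : realType) (n : nat) (Theta : countType) (Z : finType).
Variables (u : 'I_n -> Theta -> Z -> R) (f : Theta -> Z).

Lemma LYhat_sub_LY i a th : LYhat u f i a th `<=` LY u i (delta R a) th.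
Proof.
rewrite /LYhat; case: asboolP => _; last by [].
by move=> _ ->; split; [exact: lottery_delta|exact: lexx].
Qed.

Lemma SUPP_eq_delta y (a : Z) : lottery y -> SUPP y `<=` [set a] -> y = delta R a.
Proof. by move=> ly ya; apply: lottery_eq_delta => // z; exact: ya. Qed.

Lemma SUPP_delta (a : Z) : SUPP (delta R a) = [set a].
Proof.
apply/seteqP; split=> z /=; rewrite /SUPP/= /delta; last by move=> ->; rewrite eqxx oner_neq0.
by have [->|_] := eqVneq z a; last rewrite eqxx.
Qed.

(* Where [LYhat] is the singleton, every deviation of [i] keeps all outcomes in the
   [i]-max set; hence the deviation profile is an equilibrium of the state witnessing
   that set, so it yields [f] of that state, as does the original profile. *)
Lemma implementable_monotonic : mixed_Nash_implementable u f -> LYhat_monotonic u f.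
Proof.
move=> [M [g [lg gE]]] th th' sub.
have MNE_glot l t : MNE u g t l -> glot g l = delta R (f t).
  move=> lt; apply: SUPP_eq_delta; first by apply: lottery_glot => //; case: lt.
  by rewrite -gE => z lz; exists l.
have [l [lm lNE]] : exists l, MNE u g th l.
  have : [set f th] (f th) by [].
  by rewrite -gE => -[l lth _]; exists l.
have gl := MNE_glot _ _ (conj lm lNE).
(* If [l] is still an equilibrium at [th'], its only outcome is both [f th] and [f th']. *)
suff l' : MNE u g th' l.
  have := MNE_glot _ _ l'; rewrite gl => /(congr1 (fun y : Z -> R => SUPP y)).
  by rewrite !SUPP_delta => /seteqP[+ _] => /(_ (f th) erefl).
split=> // i mu mum.
have devLY (nu : M i -> R) : mixed nu -> LY u i (delta R (f th)) th (glot g (dfwith l nu)).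
  move=> num; split; first exact: lottery_glot (mixed_dfwith lm num).
  by rewrite -gl; exact: lNE.
rewrite gl; suff /sub[] : LYhat u f i (f th) th (glot g (dfwith l mu)) by [].
rewrite /LYhat; case: asboolP => [|_]; last exact: devLY.
move=> [_ [[_ amin] [t [_ [imax jmax]]]]] /=.
(* As [f th] is worst for [i] at [th], a deviation no better than it puts weight only on outcomes
   that are equally bad. *)
have devL (nu : M i -> R) z : mixed nu -> glot g (dfwith l nu) z != 0 ->
    LZ u i (delta R (f th)) th z.
  move=> num devz; rewrite /LZ/= (_ : EU _ _ _ _ = u i th (f th)); last exact: dot_delta.
  have [ldev le] := devLY _ num.
  rewrite (dot_argmin ldev _ _ devz (d := u i th (f th)) (v := u i th))//.
    by move=> z'; exact: amin.
  by move: le; rewrite [EU u i th (delta R _)]dot_delta.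
have fL : LZ u i (delta R (f th)) th (f th).
  by rewrite /LZ/= (_ : EU _ _ _ _ = u i th (f th)) //; exact: dot_delta.
have ui z : LZ u i (delta R (f th)) th z -> u i t z = u i t (f th).
  move=> Lz; apply/eqP; rewrite eq_le.
  by case: (imax z Lz) => _ /(_ _ fL)->; case: (imax _ fL) => _ /(_ _ Lz)->.
(* At [t], agent [i] is indifferent over the max set, and every other agent is already at a global
   maximum there. *)
have NE (k : forall j, M j -> R) : (forall j : 'I_n, mixed (k j)) ->
    (forall z, glot g k z != 0 -> LZ u i (delta R (f th)) th z) ->
    (forall nu : M i -> R, mixed nu ->
      forall z, glot g (dfwith k nu) z != 0 -> LZ u i (delta R (f th)) th z) ->
    MNE u g t k.
  move=> km kL kdev; split=> // j nu num.
  have lk := lottery_glot lg km; have lk' := lottery_glot lg (mixed_dfwith km num).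
  have [ji|ji] := eqVneq j i.
    move: nu num lk'; rewrite {}ji => nu num lk'.
    rewrite [leRHS](_ : _ = u i t (f th)); last first.
      by apply: dot_lottery_eq => // z kz; apply/ui/kL.
    rewrite [leLHS](_ : _ = u i t (f th))//.
    by apply: dot_lottery_eq => // z kz; apply/ui/(kdev nu).
  have jm := jmax j ji _ fL.
  rewrite [leRHS](_ : _ = u j t (f th)); last first.
    apply: dot_lottery_eq => // z /kL /(jmax j ji)[_ zm].
    by apply/eqP; rewrite eq_le zm// andbT; case: jm => _ ->.
  by apply: dot_le => // z; case: jm => _ ->.
have NEl : MNE u g t l.
  apply: NE => //.
    by move=> z; rewrite gl /delta; have [->|_] := eqVneq z (f th); last rewrite eqxx.
  by move=> nu num z; exact: devL.
rewrite (MNE_glot _ t); last first.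
  apply: NE => [|z|nu num z]; [exact: mixed_dfwith|exact: devL|].
  suff -> : dfwith (dfwith l mu) nu = dfwith l nu by exact: devL.
  apply: functional_extensionality_dep => j; have [ij|ij] := eqVneq i j.
    by case: _ / ij; rewrite !dfwith_in.
  by rewrite !dfwith_out.
by have := MNE_glot _ _ NEl; rewrite gl.
Qed.

End Necessity.

(** * Construction of the mechanism *)

Section Mechanism.
Variables (R : realType) (n : nat) (Theta : countType) (Z : finType).
Variables (u : 'I_n -> Theta -> Z -> R) (f : Theta -> Z).
Hypothesis n_ge3 : (3 <= n)%N.

(* A message [(th, 0)] asserts the state [th]; a positive integer is a challenge. *)
Definition msg (i : 'I_n) : countType := (Theta * nat)%type.
Local Notation profile := {dffun forall i : 'I_n, msg i}.
Implicit Types (m : profile) (i j k : 'I_n) (th : Theta) (y o v : Z -> R) (a z : Z).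

Definition unanimous i m th := forall k, k != i -> m k = (th, 0%N).

Definition quiet m th := (forall k, (m k).2 = 0%N) /\ exists j, unanimous j m th.

(** At most one state can qualify; if none does, the implication is void and every lottery is
    allowed. The message of [i] is not consulted. *)
Definition allowed i m : set (Z -> R) :=
  [set y | lottery y /\ forall th, unanimous i m th -> LYhat u f i (f th) th y].

(** In the numerator, 1 pays for the approximate maximum and [2 * bound v] for the move into the
    relative interior. *)
Definition good (S : set (Z -> R)) v (K : nat) o :=
  generic S o /\ forall y, S y -> dot y v <= dot o v + (1 + 2 * bound v) / K.+1%:R.

(* The outcome is a near-optimal point, for the state announced by an agent [j] with the
   highest integer, of what [j] may get against the others' messages. *)
Definition outcome m o :=
  (forall th, quiet m th -> o = delta R (f th)) /\
  ((forall th, ~ quiet m th) -> exists j, (forall k, ((m k).2 <= (m j).2)%N) /\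
     good (allowed j m) (u j (m j).1) (m j).2 o).

Lemma third_agent i j : exists k, k != i /\ k != j.
Proof.
have [k] : exists k, k \notin [set i; j]%SET.
  apply/existsP; rewrite -negb_forall; apply: contraL n_ge3 => /forallP ij.
  rewrite -ltnNge ltnS -[n]card_ord -cardsT.
  apply: leq_trans (_ : #|[set i; j]%SET| <= _)%N; last by rewrite cards2; case: (i != j).
  by apply/subset_leq_card/fintype.subsetP => k _; exact: ij.
by rewrite !inE negb_or => /andP[]; exists k.
Qed.

(** An agent other than [i] and [j] names both states in its one message. *)
Lemma unanimous_eq i j m th th' : unanimous i m th -> unanimous j m th' -> th = th'.
Proof.
move=> ui uj; have [k [/ui mk /uj]] := third_agent i j.
by rewrite mk => -[].
Qed.

Lemma LYE i a th : LY u i (delta R a) th = halfspace (u i th) (u i th a).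
Proof. by rewrite /LY /halfspace -[X in _ = [set y | _ /\ _ <= X]](dot_delta a). Qed.

Lemma LYhat_lottery i a th y : LYhat u f i a th y -> lottery y.
Proof. by move=> /LYhat_sub_LY[]. Qed.

Lemma LYhat_delta i a th : LYhat u f i a th (delta R a).
Proof.
rewrite /LYhat; case: asboolP => _ //; rewrite LYE; split; first exact: lottery_delta.
by rewrite dot_delta.
Qed.

Lemma LYhat_mix i a th t y y' : 0 <= t <= 1 -> LYhat u f i a th y ->
  LYhat u f i a th y' -> LYhat u f i a th (mix t y y').
Proof.
move=> t01; rewrite /LYhat; case: asboolP => _.
  by move=> -> ->; apply/funext => z; rewrite /mix; ring.
rewrite LYE => -[ly yc] [ly' yc']; split; first exact: lottery_mix.
case/andP: t01 => t0 t1; rewrite dot_mix.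
rewrite -[leRHS](_ : (1 - t) * u i th a + t * u i th a = _); last by ring.
by rewrite lerD// ler_wpM2l// subr_ge0.
Qed.

Lemma LYhat_generic i a th : exists y, generic (LYhat u f i a th) y.
Proof.
rewrite /LYhat; case: asboolP => _; last by rewrite LYE; exact: generic_halfspace (lexx _).
by exists (delta R a); split=> // v _ _ ->.
Qed.

Lemma allowedE i m : allowed i m = [set y | lottery y] \/
  exists2 th, unanimous i m th & allowed i m = LYhat u f i (f th) th.
Proof.
have [[th uth]|no] := pselect (exists th, unanimous i m th).
  right; exists th => //; apply/seteqP; split=> y; first by case=> _; apply.
  move=> hy; split=> [|th' uth']; first exact: LYhat_lottery hy.
  by rewrite (unanimous_eq uth' uth).
left; apply/seteqP; split=> y; first by case.
by move=> ly; split=> // th uth; case: no; exists th.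
Qed.

Lemma allowed_mix i m t y y' : 0 <= t <= 1 -> allowed i m y -> allowed i m y' ->
  allowed i m (mix t y y').
Proof.
move=> t01; have [->|[th _ ->]] := allowedE i m; last exact: LYhat_mix.
exact: lottery_mix.
Qed.

Lemma allowed_generic i m : Theta -> exists y, generic (allowed i m) y.
Proof.
move=> th0; have [->|[th _ ->]] := allowedE i m; last exact: LYhat_generic.
have [y gy] := @generic_halfspace _ _ (fun=> 0 : R) 0 (f th0) (lexx 0); exists y.
suff -> : [set y | lottery y] = halfspace (fun=> 0 : R) 0 :> set (Z -> R) by [].
apply/seteqP; split=> y'; last by case.
by move=> ly; split=> //; rewrite (dot_lottery_eq (d := 0)).
Qed.

(** A near-maximiser [y2] is mixed with a generic [y1], which gets weight [1 / K.+1]; positive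
    weight on a generic point makes the mixture generic. *)
Lemma allowed_good i m v K : Theta -> exists o, good (allowed i m) v K o.
Proof.
move=> th0; have [y1 [Sy1 gy1]] := allowed_generic i m th0.
have Sl y : allowed i m y -> lottery y by case.
pose e : R := K.+1%:R^-1; have e0 : 0 < e by rewrite invr_gt0 ltr0n.
have e1 : e <= 1 by rewrite invf_le1 ?ltr0n// ler1n.
have [y2 Sy2 y2max] := approx_max v e0 (ex_intro _ y1 Sy1) Sl.
have So : allowed i m (mix e y2 y1) by apply: allowed_mix => //; rewrite ltW.
exists (mix e y2 y1); split.
  (* A mixture maximal for [w] is at least as good as [y2], so [y1] is too, and then [y1] is at
     least as good as the mixture. *)
  split=> // w wo; have := wo _ Sy2; rewrite dot_mix => y2o.
  have y1max y : allowed i m y -> dot y w <= dot y1 w.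
    move=> /wo; rewrite dot_mix => /le_trans; apply.
    have : e * (dot y2 w - dot y1 w) <= 0 by move: y2o; lra.
    rewrite pmulr_rle0// subr_le0 => le.
    have : (1 - e) * dot y2 w <= (1 - e) * dot y1 w by rewrite ler_wpM2l// subr_ge0.
    by lra.
  by move=> y Sy; rewrite (gy1 _ y1max _ Sy) -dot_mix (gy1 _ y1max _ So).
move=> y Sy; apply: le_trans (y2max _ Sy) _; rewrite dot_mix -/e.
have /andP[b1 _] := dot_bound v (Sl _ Sy1); have /andP[_ b2] := dot_bound v (Sl _ Sy2).
have : e * (dot y2 v - dot y1 v) <= e * (2 * bound v).
  by apply: ler_wpM2l; [exact: ltW|move: b1 b2; lra].
by lra.
Qed.

Lemma outcome_exists : Theta -> exists g : profile -> Z -> R, forall m, outcome m (g m).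
Proof.
move=> th0; suff /choice[g gE] : forall m, exists o, outcome m o by exists g.
move=> m.
have [[th qth]|no] := pselect (exists th, quiet m th).
  exists (delta R (f th)); split=> [th' qth'|]; last by move=> /(_ th).
  have [_ [j uj]] := qth; have [_ [j' uj']] := qth'.
  by rewrite (unanimous_eq uj' uj).
have j0 : 'I_n := Ordinal (leq_trans (isT : 0 < 3)%N n_ge3).
pose j := [arg max_(k > j0) (m k).2]%N.
have [o go] := allowed_good j m (u j (m j).1) (m j).2 th0.
exists o; split=> [th qth|_]; first by case: no; exists th.
exists j; split=> // k; rewrite /j; case: arg_maxnP => // k' _; exact.
Qed.

(** * Incentives in the mechanism *)

Variable g : profile -> Z -> R.
Hypothesis gE : forall m, outcome m (g m).

(** If the winner is [j] and not [i], the others cannot be unanimous around [i]: the highest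
    integer, that of [j], would be 0 and the profile quiet. *)
Lemma allowed_outcome i m : allowed i m (g m).
Proof.
have [gq gnq] := gE m; have [[th qth]|no] := pselect (exists th, quiet m th).
  rewrite (gq _ qth); split=> [|th' uth']; first exact: lottery_delta.
  have [_ [j uj]] := qth; rewrite (unanimous_eq uj uth'); exact: LYhat_delta.
have {}no th : ~ quiet m th by move=> qth; apply: no; exists th.
have [j [jmax [[Sg _] _]]] := gnq no.
have [->//|ij] := eqVneq i j; split=> [|th uth]; first by case: Sg.
case: (no th); split; last by exists i.
by move=> k; apply/eqP; rewrite -leqn0 (leq_trans (jmax k))// uth// eq_sym.
Qed.

Lemma lottery_outcome m : lottery (g m).
Proof.
have i0 : 'I_n := Ordinal (leq_trans (isT : 0 < 3)%N n_ge3).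
by case: (allowed_outcome i0 m).
Qed.

(** An integer above all others makes [i] the only possible winner, with the same allowed set as
    before. *)
Lemma challenge_gain i m th (K : nat) y : (forall k, (m k).2 < K)%N -> allowed i m y ->
  dot y (u i th) <= dot (g (upd (M := msg) (i := i) (th, K) m)) (u i th)
    + (1 + 2 * bound (u i th)) / K.+1%:R.
Proof.
move=> mK Sy; set m' := upd _ _; have m'i : m' i = (th, K) by exact: upd_in.
have K0 : (0 < K)%N by apply: leq_ltn_trans (mK i).
have nq th' : ~ quiet m' th' by move=> [/(_ i)]; rewrite m'i /= => KE; rewrite KE in K0.
have [j [jmax [_]]] := (gE m').2 nq.
have -> : j = i.
  apply/eqP; apply: contraT => ji; have := jmax i.
  by rewrite m'i /m' upd_out//= leqNgt mK.
rewrite m'i /=; apply; case: Sy => ly Sy; split=> // th' uth'; apply: Sy => k ki.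
by rewrite -(uth' k ki) /m' upd_out.
Qed.

(** A challenge with the true state and a large [K] costs little wherever it wins, as the current
    outcome is itself allowed, and would gain a fixed amount at [m] if [y] were better. *)
Lemma MNE_best l th m i y : MNE u g th l -> 0 < weight l m -> allowed i m y ->
  dot y (u i th) <= dot (g m) (u i th).
Proof.
move=> [lm NE] wm Sy; rewrite leNgt; apply/negP => lt.
pose v := u i th; pose x K : msg i := (th, K).
suff : weight l m = 0 by move=> w0; rewrite w0 ltxx in wm.
apply: (@mean_no_gain _ _ (weight l) _ _ (fun m => \max_k (m k).2)%N
  (fun m => dot (g m) v + bound v) (fun K m => dot (g (upd (x K) m)) v + bound v)
  (2 * bound v) (1 + 2 * bound v) (dot y v - dot (g m) v)).
- by move=> m'; exact: weight_ge0.
- exact: mean_weight1.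
- by move=> m'; have := dot_bound v (lottery_outcome m'); lra.
- by move=> K m'; have := dot_bound v (lottery_outcome (upd (x K) m')); lra.
- by rewrite subr_gt0.
- by have := bound_ge0 v; lra.
- move=> K; rewrite -(glot_dot_shift lottery_outcome lm).
  have xm : mixed (dirac R (x K)) by exact: mixed_dirac.
  rewrite -(mean_dfwith_dirac (x K) (h := fun m => dot (g m) v + bound v) lm); last first.
    by move=> m'; have := dot_bound v (lottery_outcome m'); lra.
  rewrite -(glot_dot_shift lottery_outcome (mixed_dfwith lm xm)) lee_fin lerD2r.
  exact: NE.
- move=> K m' rK; rewrite addrAC lerD2r; apply: challenge_gain; last exact: allowed_outcome.
  by move=> k; apply: leq_ltn_trans rK; exact: leq_bigmax.
- move=> K rK.
  suff : dot y v <= dot (g (upd (x K) m)) v + (1 + 2 * bound v) / K.+1%:R.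
    by move: (_ / _) => c; lra.
  apply: challenge_gain => // k; apply: leq_ltn_trans rK; exact: leq_bigmax.
Qed.

(** A lone deviator is confined to [LYhat], hence to [LY], at the true state. *)
Lemma truthful_MNE th : exists2 l, MNE u g th l & glot g l = delta R (f th).
Proof.
pose l i : msg i -> R := dirac R ((th, 0%N) : msg i).
have lm i : mixed (l i) by exact: mixed_dirac.
have supp j (x : msg j) : 0 < l j x -> x = (th, 0%N).
  by rewrite /l /dirac; case: eqP => //; rewrite ltxx.
have gl : glot g l = delta R (f th).
  apply: (glot_delta lm) => m wm.
  have mth j : m j = (th, 0%N) by apply/supp/weight_gt0.
  have [gq _] := gE m; apply: gq; split=> [k|]; first by rewrite mth.
  by exists (Ordinal (leq_trans (isT : 0 < 3)%N n_ge3)) => k _.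
exists l => //; split=> // i mu mum; rewrite gl [leRHS]dot_delta.
have lm' := mixed_dfwith lm mum.
apply: (glot_dot_le lottery_outcome lm') => m wm.
have uth : unanimous i m th.
  move=> k ki; apply: supp; have := weight_gt0 lm' wm k.
  by rewrite dfwith_out// eq_sym.
have [_ /(_ _ uth)/LYhat_sub_LY[_]] := allowed_outcome i m.
by rewrite [leRHS]dot_delta.
Qed.

(** * Equilibrium outcomes under monotonicity *)

Hypotheses (f_nonconstant : exists th1 th2, f th1 != f th2) (mono : LYhat_monotonic u f).

(** Total indifference at [th] would give the premise of monotonicity from every state to [th],
    making [f] constant. *)
Lemma no_total_indifference th : ~ (forall i z z', u i th z <= u i th z').
Proof.
move=> ind; have fE th' : f th' = f th.
  apply: mono => i y /LYhat_lottery ly; split=> //.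
  by rewrite [leRHS]dot_delta; apply: dot_le => // z; exact: ind.
by have [th1 [th2]] := f_nonconstant; rewrite !fE eqxx.
Qed.

(** Either [g m] is degenerate at some [f t] and its optimality gives the premise of monotonicity
    from [t] to [th], or genericity leads to a contradiction. *)
Lemma best_outcome th m : (forall i y, allowed i m y -> dot y (u i th) <= dot (g m) (u i th)) ->
  g m = delta R (f th).
Proof.
move=> best; have [gq gnq] := gE m.
have sub_mono th' : (forall i, LYhat u f i (f th') th' `<=` LY u i (delta R (f th')) th) ->
    g m = delta R (f th') -> g m = delta R (f th) by move=> /mono ->.
have [[th' qth]|no] := pselect (exists th', quiet m th').
  have gm := gq _ qth; apply: sub_mono gm => i y hy.
  have ly := LYhat_lottery hy; split=> //.
  rewrite [leRHS]dot_delta -(dot_delta (f th')) -(gq _ qth); apply: best; split=> // t ut.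
  by have [_ [j uj]] := qth; rewrite (unanimous_eq ut uj).
have {}no t : ~ quiet m t by move=> qt; apply: no; exists t.
have [j [jmax [gen _]]] := gnq no.
have dS y : allowed j m y -> dot y (u j th) = dot (g m) (u j th).
  by move=> Sy; apply: (proj2 gen) => // y' Sy'; exact: best.
(* An agent other than the winner sees no unanimity, so every lottery is allowed to it. *)
have top i z : i != j -> u i th z <= dot (g m) (u i th).
  move=> ij; rewrite -(dot_delta z (u i th)); apply: best.
  split=> [|t ut]; first exact: lottery_delta.
  case: (no t); split; last by exists i.
  by move=> k; apply/eqP; rewrite -leqn0 (leq_trans (jmax k))// ut// eq_sym.
(* By genericity the support of [g m] contains that of any lottery allowed to [j], and it consists
   of outcomes best for [i]. *)
have supp i y z : i != j -> allowed j m y -> y z != 0 -> u i th z = dot (g m) (u i th).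
  move=> ij Sy yz; apply: (dot_argmax (lottery_outcome m)) => [z'|//|].
    exact: top.
  by apply: (generic_supp gen _ Sy yz) => y' [].
have false_of_const : (forall z, u j th z = dot (g m) (u j th)) ->
    (forall i z, i != j -> u i th z = dot (g m) (u i th)) -> False.
  move=> cj ci; apply: (@no_total_indifference th) => i z z'.
  by have [->|ij] := eqVneq i j; rewrite ?(cj z) ?(cj z')// (ci i z)// (ci i z').
have deltaE z : delta R z z != 0 by rewrite /delta eqxx oner_neq0.
have [SE|[t ut SE]] := allowedE j m.
  exfalso; apply: false_of_const => [z|i z ij].
    by rewrite -(dS (delta R z)) ?dot_delta// SE; exact: lottery_delta.
  by apply: (supp i (delta R z)) => //; rewrite SE; exact: lottery_delta.
have fS : allowed j m (delta R (f t)) by rewrite SE; exact: LYhat_delta.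
have Sg : allowed j m (g m) by case: gen.
move: (SE) Sg; rewrite {1}/LYhat; case: asboolP => [_ SE1|nsing].
  (* The singleton gives [j] nothing else to compare, and [f t] is best at [th] for all the
     others. *)
  rewrite SE1 => gm; apply: sub_mono (gm) => i y; have [->|ij] := eqVneq i j.
    by rewrite -SE SE1 => ->; split; [exact: lottery_delta|exact: lexx].
  move=> /LYhat_lottery ly; split=> //; rewrite [leRHS]dot_delta.
  rewrite (supp i (delta R (f t)) (f t))//.
  by apply: dot_le => // z; exact: top.
rewrite LYE => {}SE _; exfalso.
(* Slack puts a shrunken simplex in the allowed set: [j] is then indifferent over all outcomes, and
   each of them is in the support of an allowed lottery. *)
have [[z0 hz0]|nz] := pselect (exists z0, u j t z0 < u j t (f t)).
  have [s /andP[s0 s1] HX] := halfspace_slack hz0; rewrite -SE in HX.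
  apply: false_of_const => [z|i z ij]; last first.
    apply: (supp _ _ _ ij (HX z)); rewrite /mix gt_eqF//.
    have [d0 _] := lottery_delta R z0.
    by rewrite ltr_wpDl ?mulr_ge0 ?subr_ge0// /delta eqxx mulr1.
  have {}dS z' : (1 - s) * u j th z0 + s * u j th z' = dot (g m) (u j th).
    by rewrite -(dS _ (HX z')) dot_mix !dot_delta.
  have vz0 : u j th z0 = dot (g m) (u j th) by rewrite -(dS z0); ring.
  apply: (mulfI (x := s)); first by rewrite gt_eqF.
  by have := dS z; rewrite vz0; lra.
(* Now [f t] is worst for [j] at [t], and its lower contour set turns out to be a [j]-max set at
   [th]: the singleton case, excluded by [nsing]. *)
have {}nz z : u j t (f t) <= u j t z by rewrite leNgt; apply/negP => hz; apply: nz; exists z.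
have SL z : LZ u j (delta R (f t)) t z -> allowed j m (delta R z).
  rewrite /LZ/= [leRHS]dot_delta SE => zL; split; first exact: lottery_delta.
  by rewrite dot_delta.
have uL z : LZ u j (delta R (f t)) t z -> u j th z = dot (g m) (u j th).
  by move=> /SL/dS; rewrite dot_delta.
apply: nsing; split=> //; split; first by split.
exists th; split; first by exists (f t); rewrite /LZ/= [leRHS]dot_delta.
split=> [z Lz|i ij z /SL Sz]; first by split=> // z' Lz'; rewrite (uL z')// (uL z).
by split=> // z' _; rewrite (supp i (delta R z) z)//; exact: top.
Qed.

Lemma mechanism_implements th : \bigcup_(l in MNE u g th) SUPP (glot g l) = [set f th].
Proof.
have MNE_delta l : MNE u g th l -> glot g l = delta R (f th).
  move=> NE; apply: glot_delta; first by case: NE.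
  by move=> m wm; apply: best_outcome => i y Sy; exact: (MNE_best NE wm Sy).
apply/seteqP; split=> [z [l /MNE_delta ->]|_ ->]; first by rewrite SUPP_delta.
have [l NE gl] := truthful_MNE th; exists l => //.
by rewrite gl SUPP_delta.
Qed.

End Mechanism.

Theorem theorem1 (R : realType) (n : nat) (Theta : countType) (Z : finType)
    (u : 'I_n -> Theta -> Z -> R) (f : Theta -> Z) :
  (3 <= n)%N ->
  (exists th1 th2 : Theta, f th1 != f th2) ->
  mixed_Nash_implementable u f <-> LYhat_monotonic u f.
Proof.
move=> n_ge3 f_nc; split=> [|mono]; first exact: implementable_monotonic.
have [th0 _] := f_nc; have [g gE] := outcome_exists u f n_ge3 th0.
exists (msg Theta (n := n)), g; split=> [m|th]; first exact: lottery_outcome gE m.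
exact: mechanism_implements.
Qed.
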